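(* Let $\Delta\subset\mathbb{C}$ be the open unit disk and let $f:\Delta\to\Delta$ be a holomorphic map such that $f(\zeta)=\zeta+o(\zeta-1)$ as $\zeta\to 1$ non-tangentially. If $f$ has a fixed point in $\Delta$, then $f(\zeta)\equiv\zeta$.
   Context: $g(\zeta)=o(h(\zeta))$ as $\zeta\to1$ non-tangentially means that for every $M>1$, $g(\zeta)/h(\zeta)\to 0$ as $\zeta\to 1$ within $\{\zeta\in\Delta: |\zeta-1|<M(1-|\zeta|)\}$. *)

(* Defs.v *)
From Stdlib Require Import Reals.
From Coquelicot Require Import Coquelicot.

Open Scope C_scope.

Definition unit_disk (z : C) : Prop := (Cmod z < 1)%R.

Definition holomorphic_on (U : C -> Prop) (f : C -> C) : Prop :=
  forall z : C, U z -> @ex_derive C_AbsRing C_NormedModule f z.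

Definition stolz_region (M : R) (z : C) : Prop :=
  unit_disk z /\ (Cmod (z - 1) < M * (1 - Cmod z))%R.

Definition little_o_nontangential_at_1 (g h : C -> C) : Prop :=
  forall M : R, (1 < M)%R ->
    filterlim (fun z : C => g z / h z)
      (within (stolz_region M) (locally (RtoC 1))) (locally (RtoC 0)).

(* Main.v *)
Require Import Defs.
From Stdlib Require Import Reals Lra Psatz ClassicalEpsilon.
From Coquelicot Require Import Coquelicot.

(** Let p be the fixed point and phi the disk automorphism vanishing at p.  The
    map phi o f vanishes at p, so by Schwarz's lemma phi o f = h * phi with
    |h| <= 1 on the disk.  The function 1 - h is the displacement z - f(z) times
    a factor which stays bounded as z tends to 1 along the radius; hence the
    hypothesis at the boundary point says that 1 - h(r) = o(1 - r).
    Now Re (1 - h) is a nonnegative harmonic function, and by Hopf's lemma (or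
    Harnack's inequality) such a function either vanishes identically or is at
    least a constant times 1 - r.  So h is identically 1, which means f(z) = z.

    Both the definition of h and Hopf's lemma come from the Schwarz-Pick lemma in
    quotient form, [schwarz_pick_quotient], applied first at p and then at
    a point q different from p ([boundary_one_uniqueness]).  Behind it stands the
    maximum principle [maximum_modulus], needed for functions that are only known
    to be continuous at isolated points, such as h at p.

    Holomorphic means differentiable at every point, without continuity of
    the derivative, so the maximum principle rests on Goursat's theorem.  The
    proof goes directly from a bisection argument on rectangles
    ([rectangle_bisection], [goursat]) to the mean value property on circles
    ([Re_le_of_circle]) by reading the rectangle in polar coordinates. *)

Local Open Scope R_scope.

(** * Bisection of rectangles *)

Lemma nested_intervals (a b : nat -> R) :
  (forall n, a n <= a (S n)) -> (forall n, b (S n) <= b n) ->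
  (forall n, a n <= b n) ->
  exists l, forall n, a n <= l <= b n.
Proof.
  intros Ha Hb Hab.
  assert (Ha' : forall m k, a m <= a (m + k)%nat).
  { intros m; induction k as [|k IH].
    - rewrite Nat.add_0_r; lra.
    - rewrite Nat.add_succ_r; specialize (Ha (m + k)%nat); lra. }
  assert (Hb' : forall m k, b (m + k)%nat <= b m).
  { intros m; induction k as [|k IH].
    - rewrite Nat.add_0_r; lra.
    - rewrite Nat.add_succ_r; specialize (Hb (m + k)%nat); lra. }
  assert (Hmn : forall m n, a m <= b n).
  { intros m n.
    pose proof (Ha' m n); pose proof (Hb' n m); pose proof (Hab (m + n)%nat).
    rewrite (Nat.add_comm n m) in *; lra. }
  destruct (completeness (fun x => exists n, x = a n)) as [l [Hub Hleast]].
  - exists (b 0%nat); intros x [n ->]; apply Hmn.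
  - exists (a 0%nat), 0%nat; reflexivity.
  - exists l; intros n; split.
    + apply Hub; exists n; reflexivity.
    + apply Hleast; intros x [m ->]; apply Hmn.
Qed.

(** The one compactness argument, used both for Goursat's theorem and for the
    existence of maxima on closed disks.  If the property failed for the whole
    rectangle, gluing would make it fail for one of its four quarters, and so
    on; the quarters shrink to a point (a, b), where the local hypothesis
    contradicts the failure.  The scale [s] is shared by both sides, so all the
    rectangles are similar to the original one; without control of the shape the
    error terms in Goursat's theorem could not be compared with the area. *)
Lemma rectangle_bisection (P : R -> R -> R -> Prop) (x0 y0 W H : R) :
  0 <= W -> 0 <= H ->
  (forall s x y, 0 < s <= 1 ->
     x0 <= x -> x + s * W <= x0 + W -> y0 <= y -> y + s * H <= y0 + H ->
     P (s / 2) x y -> P (s / 2) (x + s / 2 * W) y ->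
     P (s / 2) x (y + s / 2 * H) ->
     P (s / 2) (x + s / 2 * W) (y + s / 2 * H) -> P s x y) ->
  (forall a b, x0 <= a <= x0 + W -> y0 <= b <= y0 + H ->
     exists delta, 0 < delta /\
     forall s x y, 0 < s < delta -> s <= 1 ->
       x0 <= x -> x + s * W <= x0 + W -> y0 <= y -> y + s * H <= y0 + H ->
       x <= a <= x + s * W -> y <= b <= y + s * H -> P s x y) ->
  P 1 x0 y0.
Proof.
  intros HW HH Hglue Hloc.
  destruct (excluded_middle_informative (P 1 x0 y0)) as [|Hbad]; [assumption|exfalso].
  (* The corner of the first quarter on which [P] fails. *)
  set (step := fun (s : R) (c : R * R) =>
    let (x, y) := c in
    if excluded_middle_informative (~ P (s / 2) x y) then (x, y) else
    if excluded_middle_informative (~ P (s / 2) (x + s / 2 * W) y)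
      then (x + s / 2 * W, y) else
    if excluded_middle_informative (~ P (s / 2) x (y + s / 2 * H))
      then (x, y + s / 2 * H) else (x + s / 2 * W, y + s / 2 * H)).
  set (c := fix c n := match n with O => (x0, y0)
                       | S m => step ((/ 2) ^ m) (c m) end).
  assert (Hs : forall n, 0 < (/ 2) ^ n <= 1).
  { induction n as [|n IH]; simpl; lra. }
  assert (Hstep : forall s x y, 0 < s <= 1 ->
     x0 <= x -> x + s * W <= x0 + W -> y0 <= y -> y + s * H <= y0 + H ->
     ~ P s x y ->
     let c' := step s (x, y) in
     ~ P (s / 2) (fst c') (snd c') /\
     x <= fst c' /\ fst c' + s / 2 * W <= x + s * W /\
     y <= snd c' /\ snd c' + s / 2 * H <= y + s * H).
  { intros s x y Hs1 Hx1 Hx2 Hy1 Hy2 HP; unfold step.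
    assert (0 <= s / 2 * W) by (apply Rmult_le_pos; lra).
    assert (0 <= s / 2 * H) by (apply Rmult_le_pos; lra).
    assert (s * W = s / 2 * W + s / 2 * W) by field.
    assert (s * H = s / 2 * H + s / 2 * H) by field.
    repeat (destruct excluded_middle_informative; [simpl; repeat split; try assumption; lra|]).
    simpl; repeat split; try lra.
    intros HP4; apply HP, Hglue; try assumption; apply NNPP; assumption. }
  assert (Hinv : forall n, ~ P ((/ 2) ^ n) (fst (c n)) (snd (c n)) /\
     x0 <= fst (c n) /\ fst (c n) + (/ 2) ^ n * W <= x0 + W /\
     y0 <= snd (c n) /\ snd (c n) + (/ 2) ^ n * H <= y0 + H).
  { induction n as [|n IH].
    - simpl; repeat split; try assumption; lra.
    - destruct IH as (I1 & I2 & I3 & I4 & I5).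
      destruct (Hstep _ _ _ (Hs n) I2 I3 I4 I5 I1) as (J1 & J2 & J3 & J4 & J5).
      rewrite <- surjective_pairing in J1, J2, J3, J4, J5.
      change (step ((/ 2) ^ n) (c n)) with (c (S n)) in *.
      replace ((/ 2) ^ S n) with ((/ 2) ^ n / 2) by (simpl; field).
      repeat split; try assumption; lra. }
  assert (Hnext : forall n, fst (c n) <= fst (c (S n)) /\
     fst (c (S n)) + (/ 2) ^ S n * W <= fst (c n) + (/ 2) ^ n * W /\
     snd (c n) <= snd (c (S n)) /\
     snd (c (S n)) + (/ 2) ^ S n * H <= snd (c n) + (/ 2) ^ n * H).
  { intros n; destruct (Hinv n) as (I1 & I2 & I3 & I4 & I5).
    destruct (Hstep _ _ _ (Hs n) I2 I3 I4 I5 I1) as (J1 & J2 & J3 & J4 & J5).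
    rewrite <- surjective_pairing in J1, J2, J3, J4, J5.
    change (step ((/ 2) ^ n) (c n)) with (c (S n)) in *.
    replace ((/ 2) ^ S n) with ((/ 2) ^ n / 2) by (simpl; field).
    repeat split; assumption. }
  destruct (nested_intervals (fun n => fst (c n)) (fun n => fst (c n) + (/ 2) ^ n * W))
    as [a Ha]; try (intros n; apply Hnext).
  { intros n; pose proof (Rmult_le_pos ((/2)^n) W); specialize (Hs n); lra. }
  destruct (nested_intervals (fun n => snd (c n)) (fun n => snd (c n) + (/ 2) ^ n * H))
    as [b Hb]; try (intros n; apply Hnext).
  { intros n; pose proof (Rmult_le_pos ((/2)^n) H); specialize (Hs n); lra. }
  simpl in Ha, Hb.
  destruct (Hloc a b) as [delta [Hd HP]].
  { pose proof (Ha 0%nat) as E; simpl in E; lra. }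
  { pose proof (Hb 0%nat) as E; simpl in E; lra. }
  destruct (pow_lt_1_zero (/ 2)) with (y := delta) as [N HN]; [rewrite Rabs_pos_eq; lra|lra|].
  specialize (HN N (Nat.le_refl N)); rewrite Rabs_pos_eq in HN by (specialize (Hs N); lra).
  destruct (Hinv N) as (I1 & I2 & I3 & I4 & I5).
  apply I1, HP; try assumption; try apply Hs; auto.
  split; [apply Hs|assumption].
Qed.

(** * Goursat's theorem *)

(** Flux of the field (U, -V) out of the rectangle with corner (x, y) and sides
    w, h; equivalently, the imaginary part of the contour integral of U + iV. *)
Definition flux (U V : R -> R -> R) (x y w h : R) : R :=
  RInt (fun t => U (x + w) t - U x t) y (y + h)
  - RInt (fun t => V t (y + h) - V t y) x (x + w).

Lemma continuity_2d_pt_snd (U : R -> R -> R) (x y : R) :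
  continuity_2d_pt U x y -> continuous (fun t => U x t) y.
Proof.
  intros HU; apply continuity_pt_filterlim.
  intros eps Heps; destruct (HU (mkposreal eps Heps)) as [d Hd].
  exists d; split; [apply cond_pos|].
  intros t [_ Ht]; apply Hd; [|exact Ht].
  rewrite Rminus_diag, Rabs_R0; apply cond_pos.
Qed.

Lemma continuity_2d_pt_fst (U : R -> R -> R) (x y : R) :
  continuity_2d_pt U x y -> continuous (fun t => U t y) x.
Proof.
  intros HU; apply continuity_pt_filterlim.
  intros eps Heps; destruct (HU (mkposreal eps Heps)) as [d Hd].
  exists d; split; [apply cond_pos|].
  intros t [_ Ht]; apply Hd; [exact Ht|].
  rewrite Rminus_diag, Rabs_R0; apply cond_pos.
Qed.

Lemma RInt_increment_bound (f : R -> R) (a w m e : R) :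
  0 <= w -> ex_RInt f a (a + w) ->
  (forall t, a <= t <= a + w -> Rabs (f t - m) <= e) ->
  Rabs (RInt f a (a + w) - m * w) <= e * w.
Proof.
  intros Hw Hf He.
  assert (E : RInt (fun t => minus (f t) m) a (a + w) = RInt f a (a + w) - m * w).
  { etransitivity;
      [apply (RInt_minus (V := R_CompleteNormedModule)); [assumption|apply ex_RInt_const]|].
    rewrite RInt_const; unfold minus, plus, opp, scal; simpl; unfold mult; simpl; ring. }
  rewrite <- E.
  replace (e * w) with ((a + w - a) * e) by ring.
  apply abs_RInt_le_const; [lra| |assumption].
  apply (ex_RInt_minus (V := R_NormedModule)); [assumption|apply ex_RInt_const].
Qed.

(** Goursat's argument for a field of zero divergence.  Nothing is assumed on
    the continuity of the derivatives, so the divergence theorem cannot be used.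
    The flux is additive under subdivision, while on a rectangle of scale s
    around a point of differentiability it is o(s^2): the affine part contributes
    m * w * h from U and the same from V, which cancel.  Hence the flux is at
    most eps * s^2 on every rectangle of scale s. *)
Lemma goursat (U V : R -> R -> R) (x0 y0 W H : R) :
  0 < W -> 0 < H ->
  (forall x y, x0 <= x <= x0 + W -> y0 <= y <= y0 + H ->
     exists m uy vx, differentiable_pt_lim U x y m uy /\
                     differentiable_pt_lim V x y vx m) ->
  flux U V x0 y0 W H = 0.
Proof.
  intros HW HH Hdiff.
  assert (HcU : forall x y, x0 <= x <= x0 + W -> y0 <= y <= y0 + H ->
             continuity_2d_pt U x y).
  { intros x y Hx Hy; destruct (Hdiff x y Hx Hy) as (m & uy & vx & D & _).
    apply differentiable_continuity_pt; exists m, uy; exact D. }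
  assert (HcV : forall x y, x0 <= x <= x0 + W -> y0 <= y <= y0 + H ->
             continuity_2d_pt V x y).
  { intros x y Hx Hy; destruct (Hdiff x y Hx Hy) as (m & uy & vx & _ & D).
    apply differentiable_continuity_pt; exists vx, m; exact D. }
  assert (HiU : forall x1 x2 y h, x0 <= x1 <= x0 + W -> x0 <= x2 <= x0 + W ->
            0 <= h -> y0 <= y -> y + h <= y0 + H ->
            ex_RInt (fun t => U x2 t - U x1 t) y (y + h)).
  { intros x1 x2 y h Hx1 Hx2 Hh Hy Hyh.
    apply (ex_RInt_minus (V := R_NormedModule));
    apply (ex_RInt_continuous (V := R_CompleteNormedModule)); intros t Ht;
    rewrite Rmin_left, Rmax_right in Ht by lra;
    apply continuity_2d_pt_snd, HcU; lra. }
  assert (HiV : forall y1 y2 x w, y0 <= y1 <= y0 + H -> y0 <= y2 <= y0 + H ->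
            0 <= w -> x0 <= x -> x + w <= x0 + W ->
            ex_RInt (fun t => V t y2 - V t y1) x (x + w)).
  { intros y1 y2 x w Hy1 Hy2 Hw Hx Hxw.
    apply (ex_RInt_minus (V := R_NormedModule));
    apply (ex_RInt_continuous (V := R_CompleteNormedModule)); intros t Ht;
    rewrite Rmin_left, Rmax_right in Ht by lra;
    apply continuity_2d_pt_fst, HcV; lra. }
  assert (Hmain : forall eps, 0 < eps -> Rabs (flux U V x0 y0 W H) <= eps).
  { intros eps Heps.
    cut (Rabs (flux U V x0 y0 (1 * W) (1 * H)) <= eps * 1 ^ 2).
    { rewrite !Rmult_1_l, pow1, Rmult_1_r; trivial. }
    apply (rectangle_bisection
             (fun s x y => Rabs (flux U V x y (s * W) (s * H)) <= eps * s ^ 2)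
             x0 y0 W H);
      [lra|lra| |].
    - intros s x y Hs Hx1 Hx2 Hy1 Hy2 P1 P2 P3 P4.
      set (w := s / 2 * W) in *; set (h := s / 2 * H) in *.
      assert (0 <= w) by (apply Rmult_le_pos; lra).
      assert (0 <= h) by (apply Rmult_le_pos; lra).
      replace (s * W) with (w + w) in * by (unfold w; field).
      replace (s * H) with (h + h) in * by (unfold h; field).
      assert (E : flux U V x y (w + w) (h + h) =
        flux U V x y w h + flux U V (x + w) y w h + flux U V x (y + h) w h
        + flux U V (x + w) (y + h) w h).
      { unfold flux.
        assert (CU : forall x1 x2, x0 <= x1 <= x0 + W -> x0 <= x2 <= x0 + W ->
          RInt (fun t => U x2 t - U x1 t) y (y + (h + h)) =
          RInt (fun t => U x2 t - U x1 t) y (y + h) +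
          RInt (fun t => U x2 t - U x1 t) (y + h) (y + h + h)).
        { intros x1 x2 Hx1' Hx2'. rewrite <- Rplus_assoc. symmetry.
          apply (RInt_Chasles (V := R_CompleteNormedModule)); apply HiU; lra. }
        assert (CV : forall y1 y2, y0 <= y1 <= y0 + H -> y0 <= y2 <= y0 + H ->
          RInt (fun t => V t y2 - V t y1) x (x + (w + w)) =
          RInt (fun t => V t y2 - V t y1) x (x + w) +
          RInt (fun t => V t y2 - V t y1) (x + w) (x + w + w)).
        { intros y1 y2 Hy1' Hy2'. rewrite <- Rplus_assoc. symmetry.
          apply (RInt_Chasles (V := R_CompleteNormedModule)); apply HiV; lra. }
        rewrite CU, CV by lra.
        assert (AU : forall z k, y0 <= z -> 0 <= k -> z + k <= y0 + H ->
          RInt (fun t => U (x + (w + w)) t - U x t) z (z + k) =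
          RInt (fun t => U (x + w) t - U x t) z (z + k) +
          RInt (fun t => U (x + w + w) t - U (x + w) t) z (z + k)).
        { intros z k Hz Hk Hzk.
          rewrite <- (RInt_plus (V := R_CompleteNormedModule)) by (apply HiU; lra).
          apply RInt_ext; intros t _; rewrite <- Rplus_assoc; unfold plus; simpl; ring. }
        assert (AV : forall z k, x0 <= z -> 0 <= k -> z + k <= x0 + W ->
          RInt (fun t => V t (y + (h + h)) - V t y) z (z + k) =
          RInt (fun t => V t (y + h) - V t y) z (z + k) +
          RInt (fun t => V t (y + h + h) - V t (y + h)) z (z + k)).
        { intros z k Hz Hk Hzk.
          rewrite <- (RInt_plus (V := R_CompleteNormedModule)) by (apply HiV; lra).
          apply RInt_ext; intros t _; rewrite <- Rplus_assoc; unfold plus; simpl; ring. }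
        rewrite !AU, !AV by lra; ring. }
      rewrite E.
      replace (eps * s ^ 2) with (eps * (s / 2) ^ 2 + eps * (s / 2) ^ 2
         + eps * (s / 2) ^ 2 + eps * (s / 2) ^ 2) by field.
      repeat (eapply Rle_trans; [apply Rabs_triang|apply Rplus_le_compat]; try assumption).
    - intros a b Ha Hb.
      destruct (Hdiff a b Ha Hb) as (m & uy & vx & DU & DV).
      set (L := W + H).
      assert (HL : 0 < L) by (unfold L; lra).
      assert (Heta : 0 < eps / (2 * L ^ 2)).
      { apply Rdiv_lt_0_compat; [lra|]; nra. }
      (* The first-order error is at most [eta * (s * L)] on the rectangle; it is
         counted twice on each pair of sides, and the sides add up to [s * L]. *)
      set (eta := mkposreal _ Heta).
      destruct (DU eta) as [d1 Hd1]; destruct (DV eta) as [d2 Hd2].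
      exists (Rmin d1 d2 / L); split.
      { apply Rdiv_lt_0_compat; [apply Rmin_pos; apply cond_pos|lra]. }
      intros s x y Hs Hs1 Hx1 Hx2 Hy1 Hy2 Hxa Hyb.
      assert (HsL : s * L < Rmin d1 d2).
      { destruct Hs as [_ Hs]; apply (Rmult_lt_compat_r L) in Hs; [|lra].
        unfold Rdiv in Hs; rewrite Rmult_assoc, Rinv_l, Rmult_1_r in Hs; lra. }
      pose proof (Rmin_l d1 d2); pose proof (Rmin_r d1 d2).
      assert (0 <= s * W) by (apply Rmult_le_pos; lra).
      assert (0 <= s * H) by (apply Rmult_le_pos; lra).
      assert (EL : s * L = s * W + s * H) by (unfold L; ring).
      assert (Hfar : forall x' y', x <= x' <= x + s * W -> y <= y' <= y + s * H ->
         Rabs (x' - a) <= s * L /\ Rabs (y' - b) <= s * L).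
      { intros x' y' Hx' Hy'; split; apply Rabs_le; lra. }
      assert (HM : forall x' y', x <= x' <= x + s * W -> y <= y' <= y + s * H ->
         eta * Rmax (Rabs (x' - a)) (Rabs (y' - b)) <= eta * (s * L)).
      { intros x' y' Hx' Hy'; apply Rmult_le_compat_l; [apply Rlt_le, cond_pos|].
        destruct (Hfar x' y' Hx' Hy'); apply Rmax_lub; assumption. }
      assert (HU : forall x' y', x <= x' <= x + s * W -> y <= y' <= y + s * H ->
         Rabs (U x' y' - U a b - (m * (x' - a) + uy * (y' - b))) <= eta * (s * L)).
      { intros x' y' Hx' Hy'; destruct (Hfar x' y' Hx' Hy').
        eapply Rle_trans; [apply Hd1; lra|apply HM; assumption]. }
      assert (HV : forall x' y', x <= x' <= x + s * W -> y <= y' <= y + s * H ->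
         Rabs (V x' y' - V a b - (vx * (x' - a) + m * (y' - b))) <= eta * (s * L)).
      { intros x' y' Hx' Hy'; destruct (Hfar x' y' Hx' Hy').
        eapply Rle_trans; [apply Hd2; lra|apply HM; assumption]. }
      unfold flux.
      assert (B1 := RInt_increment_bound (fun t => U (x + s * W) t - U x t) y (s * H)
                (m * (s * W)) (2 * (eta * (s * L))) ltac:(lra)
                (HiU x (x + s * W) y (s * H) ltac:(lra) ltac:(lra) ltac:(lra) ltac:(lra) ltac:(lra))).
      assert (B2 := RInt_increment_bound (fun t => V t (y + s * H) - V t y) x (s * W)
                (m * (s * H)) (2 * (eta * (s * L))) ltac:(lra)
                (HiV y (y + s * H) x (s * W) ltac:(lra) ltac:(lra) ltac:(lra) ltac:(lra) ltac:(lra))).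
      lapply B1; [clear B1; intros B1|].
      2:{ intros t Ht.
          assert (T1 := HU (x + s * W) t ltac:(lra) ltac:(lra)).
          assert (T2 := HU x t ltac:(lra) ltac:(lra)).
          apply Rabs_le_between in T1, T2; apply Rabs_le; lra. }
      lapply B2; [clear B2; intros B2|].
      2:{ intros t Ht.
          assert (T1 := HV t (y + s * H) ltac:(lra) ltac:(lra)).
          assert (T2 := HV t y ltac:(lra) ltac:(lra)).
          apply Rabs_le_between in T1, T2; apply Rabs_le; lra. }
      assert (Etot : eps * s ^ 2 = 2 * (eta * (s * L)) * (s * H) + 2 * (eta * (s * L)) * (s * W)).
      { replace (2 * (eta * (s * L)) * (s * H) + 2 * (eta * (s * L)) * (s * W))
          with (2 * eta * s ^ 2 * L * (W + H)) by ring.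
        fold L; simpl; field; lra. }
      apply Rabs_le_between in B1, B2; apply Rabs_le; rewrite Etot; lra. }
  destruct (Req_dec (flux U V x0 y0 W H) 0) as [|Hne]; [assumption|exfalso].
  apply Rabs_pos_lt in Hne.
  specialize (Hmain (Rabs (flux U V x0 y0 W H) / 2)); lra.
Qed.

(** * Pointwise complex differentiability *)

Definition continuous_at (g : C -> C) (z : C) : Prop :=
  forall eps, 0 < eps -> exists d, 0 < d /\
    forall w : C, Cmod (w - z) < d -> Cmod (g w - g z) < eps.

(** Complex differentiability in Caratheodory's form.  The difference quotient
    [F] is then available as a function continuous at [z], which makes the
    product and inverse rules algebraic and directly provides the continuous
    extension of g(w) / (w - z) to z when g(z) = 0. *)
Definition differentiable_at (g : C -> C) (z : C) : Prop :=
  exists F d, 0 < d /\ continuous_at F z /\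
    forall w : C, Cmod (w - z) < d -> (g w - g z = F w * (w - z))%C.

Lemma Cminus_diag (z : C) : (z - z = 0)%C.
Proof. ring. Qed.

Lemma Cmod_reverse_triangle (z w : C) : Cmod z - Cmod w <= Cmod (z - w).
Proof.
  pose proof (Cmod_triangle (z - w) w) as T.
  replace (z - w + w)%C with z in T by ring; lra.
Qed.

Lemma Cmod_minus_sym (z w : C) : Cmod (z - w) = Cmod (w - z).
Proof. rewrite <- Cmod_opp; f_equal; ring. Qed.

Lemma Cmod_le_2_Rmax (z : C) : Cmod z <= 2 * Rmax (Rabs (fst z)) (Rabs (snd z)).
Proof.
  eapply Rle_trans; [apply Cmod_2Rmax|apply Rmult_le_compat_r].
  - eapply Rle_trans; [apply Rabs_pos|apply Rmax_l].
  - rewrite <- (sqrt_square 2) at 2 by lra; apply sqrt_le_1; lra.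
Qed.

Lemma continuous_at_ext_loc (g h : C -> C) (z : C) (d : R) :
  0 < d -> (forall w, Cmod (w - z) < d -> g w = h w) -> continuous_at g z -> continuous_at h z.
Proof.
  intros Hd E Hg eps Heps; destruct (Hg eps Heps) as [d1 [Hd1 H]].
  exists (Rmin d d1); split; [apply Rmin_pos; assumption|].
  intros w Hw; pose proof (Rmin_l d d1); pose proof (Rmin_r d d1).
  rewrite <- !E; [apply H; lra| |lra].
  rewrite Cminus_diag, Cmod_0; assumption.
Qed.

Lemma continuous_at_const (a z : C) : continuous_at (fun _ => a) z.
Proof.
  intros eps Heps; exists 1; split; [lra|]; intros w _.
  rewrite Cminus_diag, Cmod_0; assumption.
Qed.

Lemma continuous_at_id (z : C) : continuous_at (fun w => w) z.
Proof. intros eps Heps; exists eps; auto. Qed.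

Lemma continuous_at_plus (g h : C -> C) (z : C) :
  continuous_at g z -> continuous_at h z -> continuous_at (fun w => g w + h w)%C z.
Proof.
  intros Hg Hh eps Heps.
  destruct (Hg (eps / 2) ltac:(lra)) as [d1 [Hd1 H1]].
  destruct (Hh (eps / 2) ltac:(lra)) as [d2 [Hd2 H2]].
  exists (Rmin d1 d2); split; [apply Rmin_pos; assumption|].
  intros w Hw; pose proof (Rmin_l d1 d2); pose proof (Rmin_r d1 d2).
  replace (g w + h w - (g z + h z))%C with ((g w - g z) + (h w - h z))%C by ring.
  specialize (H1 w ltac:(lra)); specialize (H2 w ltac:(lra)).
  eapply Rle_lt_trans; [apply Cmod_triangle|lra].
Qed.

Lemma continuous_at_mult (g h : C -> C) (z : C) :
  continuous_at g z -> continuous_at h z -> continuous_at (fun w => g w * h w)%C z.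
Proof.
  intros Hg Hh eps Heps.
  pose proof (Cmod_ge_0 (g z)); pose proof (Cmod_ge_0 (h z)).
  set (K := Cmod (g z) + Cmod (h z) + 1).
  assert (HK : 0 < K) by (unfold K; lra).
  set (e := Rmin 1 (eps / (2 * K))).
  assert (He : 0 < e) by (apply Rmin_pos; [lra|apply Rdiv_lt_0_compat; lra]).
  assert (He1 : e <= 1) by apply Rmin_l.
  assert (HeK : e * K <= eps / 2).
  { apply Rle_trans with (eps / (2 * K) * K).
    - apply Rmult_le_compat_r; [lra|apply Rmin_r].
    - right; field; lra. }
  destruct (Hg e He) as [d1 [Hd1 H1]].
  destruct (Hh e He) as [d2 [Hd2 H2]].
  exists (Rmin d1 d2); split; [apply Rmin_pos; assumption|].
  intros w Hw; pose proof (Rmin_l d1 d2); pose proof (Rmin_r d1 d2).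
  specialize (H1 w ltac:(lra)); specialize (H2 w ltac:(lra)).
  replace (g w * h w - g z * h z)%C with
    ((g w - g z) * (h w - h z) + (g w - g z) * h z + g z * (h w - h z))%C by ring.
  eapply Rle_lt_trans; [apply Cmod_triangle|].
  pose proof (Cmod_triangle ((g w - g z) * (h w - h z)) ((g w - g z) * h z)).
  rewrite !Cmod_mult in *.
  pose proof (Cmod_ge_0 (g w - g z)); pose proof (Cmod_ge_0 (h w - h z)).
  unfold K in HeK; nra.
Qed.

Lemma continuous_at_inv (g : C -> C) (z : C) :
  g z <> 0 -> continuous_at g z -> continuous_at (fun w => / g w)%C z.
Proof.
  intros Hz Hg eps Heps.
  apply Cmod_gt_0 in Hz as Hz'.
  set (a := Cmod (g z)) in *.
  assert (Ha2 : 0 < a ^ 2) by nra.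
  set (e := Rmin (a / 2) (eps * a ^ 2 / 4)).
  assert (He : 0 < e) by (apply Rmin_pos; nra).
  destruct (Hg e He) as [d [Hd H]].
  exists d; split; [assumption|]; intros w Hw; specialize (H w Hw).
  pose proof (Rmin_l (a / 2) (eps * a ^ 2 / 4)).
  pose proof (Rmin_r (a / 2) (eps * a ^ 2 / 4)).
  fold e in H0, H1.
  assert (Hgw : a / 2 < Cmod (g w)).
  { pose proof (Cmod_reverse_triangle (g z) (g w)) as T.
    rewrite Cmod_minus_sym in T; fold a in T; lra. }
  assert (Hw0 : g w <> 0) by (apply Cmod_gt_0; lra).
  replace (/ g w - / g z)%C with (- (g w - g z) / (g w * g z))%C by (field; auto).
  rewrite Cmod_div, Cmod_opp, Cmod_mult by (apply Cmult_neq_0; assumption).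
  fold a; apply Rlt_div_l; [apply Rmult_lt_0_compat; lra|].
  assert (a * (a / 2) < Cmod (g w) * a) by nra.
  nra.
Qed.

Lemma differentiable_at_ext_loc (g h : C -> C) (z : C) (d : R) :
  0 < d -> (forall w, Cmod (w - z) < d -> g w = h w) -> differentiable_at g z -> differentiable_at h z.
Proof.
  intros Hd E (F & d1 & Hd1 & HF & H).
  exists F, (Rmin d d1); split; [apply Rmin_pos; assumption|split; [assumption|]].
  intros w Hw; pose proof (Rmin_l d d1); pose proof (Rmin_r d d1).
  rewrite <- !E; [apply H; lra| |lra].
  rewrite Cminus_diag, Cmod_0; assumption.
Qed.

Lemma differentiable_at_const (a z : C) : differentiable_at (fun _ => a) z.
Proof.
  exists (fun _ => 0%C), 1; split; [lra|split; [apply continuous_at_const|]]; intros; ring.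
Qed.

Lemma differentiable_at_id (z : C) : differentiable_at (fun w => w) z.
Proof.
  exists (fun _ => 1%C), 1; split; [lra|split; [apply continuous_at_const|]]; intros; ring.
Qed.

Lemma differentiable_at_continuous_at (g : C -> C) (z : C) : differentiable_at g z -> continuous_at g z.
Proof.
  intros (F & d & Hd & HF & H).
  apply continuous_at_ext_loc with (fun w => F w * (w + - z) + g z)%C d; [assumption| |].
  - intros w Hw; change (w + - z)%C with (w - z)%C; rewrite <- H by assumption; ring.
  - apply continuous_at_plus; [apply continuous_at_mult; [assumption|]|apply continuous_at_const].
    apply continuous_at_plus; [apply continuous_at_id|apply continuous_at_const].
Qed.

Lemma differentiable_at_plus (g h : C -> C) (z : C) :
  differentiable_at g z -> differentiable_at h z -> differentiable_at (fun w => g w + h w)%C z.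
Proof.
  intros (F & d1 & Hd1 & HF & H1) (G & d2 & Hd2 & HG & H2).
  exists (fun w => F w + G w)%C, (Rmin d1 d2).
  split; [apply Rmin_pos; assumption|split; [apply continuous_at_plus; assumption|]].
  intros w Hw; pose proof (Rmin_l d1 d2); pose proof (Rmin_r d1 d2).
  replace (g w + h w - (g z + h z))%C with ((g w - g z) + (h w - h z))%C by ring.
  rewrite H1, H2 by lra; ring.
Qed.

Lemma differentiable_at_mult (g h : C -> C) (z : C) :
  differentiable_at g z -> differentiable_at h z -> differentiable_at (fun w => g w * h w)%C z.
Proof.
  intros Hg Hh; pose proof (differentiable_at_continuous_at _ _ Hg) as Cg.
  destruct Hg as (F & d1 & Hd1 & HF & H1); destruct Hh as (G & d2 & Hd2 & HG & H2).
  exists (fun w => F w * h z + g w * G w)%C, (Rmin d1 d2).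
  split; [apply Rmin_pos; assumption|split].
  - apply continuous_at_plus; apply continuous_at_mult; auto using continuous_at_const.
  - intros w Hw; pose proof (Rmin_l d1 d2); pose proof (Rmin_r d1 d2).
    replace (g w * h w - g z * h z)%C
      with ((g w - g z) * h z + g w * (h w - h z))%C by ring.
    rewrite H1, H2 by lra; ring.
Qed.

Lemma differentiable_at_inv (g : C -> C) (z : C) :
  g z <> 0 -> differentiable_at g z -> differentiable_at (fun w => / g w)%C z.
Proof.
  intros Hz Hg; pose proof (differentiable_at_continuous_at _ _ Hg) as Cg.
  destruct Hg as (F & d1 & Hd1 & HF & H1).
  apply Cmod_gt_0 in Hz as Hz'.
  destruct (Cg (Cmod (g z)) Hz') as (d2 & Hd2 & H2).
  exists (fun w => - / g z * (F w * / g w))%C, (Rmin d1 d2).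
  split; [apply Rmin_pos; assumption|split].
  - apply continuous_at_mult; [apply continuous_at_const|].
    apply continuous_at_mult; [assumption|apply continuous_at_inv; assumption].
  - intros w Hw; pose proof (Rmin_l d1 d2); pose proof (Rmin_r d1 d2).
    specialize (H2 w ltac:(lra)).
    assert (Hw0 : g w <> 0).
    { intros E; rewrite E in H2.
      replace (0 - g z)%C with (- g z)%C in H2 by ring; rewrite Cmod_opp in H2; lra. }
    replace (/ g w - / g z)%C with (- / g z * (g w - g z) * / g w)%C by (field; auto).
    rewrite H1 by lra; ring.
Qed.

Lemma ex_derive_differentiable_at (f : C -> C) (z : C) :
  @ex_derive C_AbsRing C_NormedModule f z -> differentiable_at f z.
Proof.
  intros [l [_ Hl]].
  specialize (Hl z (fun P H => H)).
  exists (fun w => if excluded_middle_informative (w = z) then l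
                   else ((f w - f z) / (w - z))%C), 1.
  split; [lra|split].
  - intros eps Heps.
    assert (Heps2 : 0 < eps / 2) by lra.
    destruct (Hl (mkposreal _ Heps2)) as [d Hd].
    exists d; split; [apply cond_pos|]; intros w Hw.
    destruct (excluded_middle_informative (z = z)) as [_|]; [|congruence].
    destruct excluded_middle_informative as [|Hne].
    + rewrite Cminus_diag, Cmod_0; assumption.
    + assert (Hne' : (w - z)%C <> 0).
      { intros E; apply Hne; replace w with (w - z + z)%C by ring; rewrite E; ring. }
      apply Cmod_gt_0 in Hne' as Hpos.
      specialize (Hd w).
      lapply Hd; [clear Hd; intros Hd|].
      2:{ exact Hw. }
      assert (Hd' : Cmod (f w - f z - (w - z) * l) <= eps / 2 * Cmod (w - z)).
      { exact Hd. }
      replace ((f w - f z) / (w - z) - l)%C with ((f w - f z - (w - z) * l) / (w - z))%C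
        by (field; assumption).
      rewrite Cmod_div by assumption.
      apply Rlt_div_l; [assumption|]. nra.
  - intros w _; destruct excluded_middle_informative as [->|Hne]; [ring|].
    field; intros E; apply Hne; replace w with (w - z + z)%C by ring; rewrite E; ring.
Qed.

Lemma cauchy_riemann (g F : C -> C) (x y d : R) :
  0 < d -> continuous_at F (x, y) ->
  (forall w, Cmod (w - (x, y)) < d -> (g w - g (x, y) = F w * (w - (x, y)))%C) ->
  differentiable_pt_lim (fun u v => Re (g (u, v))) x y (Re (F (x, y))) (- Im (F (x, y))) /\
  differentiable_pt_lim (fun u v => Im (g (u, v))) x y (Im (F (x, y))) (Re (F (x, y))).
Proof.
  intros Hd HF H; set (z := (x, y) : C) in *.
  assert (Hmain : forall eps : posreal, exists d' : posreal, forall u v,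
    Rabs (u - x) < d' -> Rabs (v - y) < d' ->
    Cmod (g (u, v) - g z - F z * ((u, v) - z))
      <= eps * Rmax (Rabs (u - x)) (Rabs (v - y))).
  { intros eps.
    assert (He2 : 0 < eps / 2) by (pose proof (cond_pos eps); lra).
    destruct (HF _ He2) as [d1 [Hd1 H1]].
    assert (Hm : 0 < Rmin d d1 / 2) by (pose proof (Rmin_pos _ _ Hd Hd1); lra).
    exists (mkposreal _ Hm); simpl; intros u v Hu Hv.
    pose proof (Rmin_l d d1); pose proof (Rmin_r d d1).
    set (w := (u, v) : C).
    pose proof (Cmod_le_2_Rmax (w - z)) as T.
    change (fst (w - z)%C) with (u - x) in T; change (snd (w - z)%C) with (v - y) in T.
    set (M := Rmax (Rabs (u - x)) (Rabs (v - y))) in *.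
    assert (HM : M < Rmin d d1 / 2) by (apply Rmax_lub_lt; assumption).
    assert (HM0 : 0 <= M) by (eapply Rle_trans; [apply Rabs_pos|apply Rmax_l]).
    rewrite H by lra.
    replace (F w * (w - z) - F z * (w - z))%C with ((F w - F z) * (w - z))%C by ring.
    rewrite Cmod_mult; specialize (H1 w ltac:(lra)).
    pose proof (Cmod_ge_0 (F w - F z)); pose proof (Cmod_ge_0 (w - z)).
    nra. }
  split; intros eps; destruct (Hmain eps) as [d' Hd']; exists d'; intros u v Hu Hv;
    (eapply Rle_trans; [|apply Hd'; assumption]);
    (eapply Rle_trans; [|apply Rmax_Cmod]).
  - eapply Rle_trans; [|apply Rmax_l]; right; f_equal; unfold z, Re, Im; simpl; ring.
  - eapply Rle_trans; [|apply Rmax_r]; right; f_equal; unfold z, Re, Im; simpl; ring.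
Qed.

(** * The mean value property *)

Definition circle_point (c : C) (r t : R) : C := (fst c + r * cos t, snd c + r * sin t).

Lemma Cmod_circle_point (c : C) (r t : R) :
  0 <= r -> Cmod (circle_point c r t - c) = r.
Proof.
  intros Hr; unfold Cmod; simpl.
  transitivity (sqrt (r ^ 2)); [f_equal|apply sqrt_pow2; assumption].
  pose proof (sin2_cos2 t) as E; unfold Rsqr in E.
  transitivity (r ^ 2 * (sin t * sin t + cos t * cos t)); [ring|rewrite E; ring].
Qed.

Lemma differentiable_pt_lim_mult (x y : R) :
  differentiable_pt_lim (fun u v => u * v) x y y x.
Proof.
  intros eps; exists eps; intros u v Hu Hv.
  replace (u * v - x * y - (y * (u - x) + x * (v - y))) with ((u - x) * (v - y)) by ring.
  rewrite Rabs_mult; apply Rmult_le_compat; try apply Rabs_pos; [lra|apply Rmax_r].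
Qed.

Lemma differentiable_pt_lim_snd (x y : R) :
  differentiable_pt_lim (fun _ v => v) x y 0 1.
Proof.
  intros eps; exists eps; intros u v Hu Hv.
  replace (v - y - (0 * (u - x) + 1 * (v - y))) with 0 by ring.
  rewrite Rabs_R0; apply Rmult_le_pos; [apply Rlt_le, cond_pos|].
  eapply Rle_trans; [apply Rabs_pos|apply Rmax_l].
Qed.

Lemma differentiable_pt_lim_polar (a r t : R) (s : R -> R) (ds : R) :
  derivable_pt_lim s t ds ->
  differentiable_pt_lim (fun r t => a + r * s t) r t (s t) (r * ds).
Proof.
  intros Hs.
  assert (D1 : differentiable_pt_lim (fun _ t => s t) r t (ds * 0 + 0 * 0) (ds * 1 + 0 * 1)).
  { apply (differentiable_pt_lim_comp (fun u _ => s u) (fun _ v => v) (fun _ v => v));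
      [apply differentiable_pt_lim_proj1_0; assumption| |]; apply differentiable_pt_lim_snd. }
  assert (D2 : differentiable_pt_lim (fun r _ => r) r t 1 0).
  { apply (differentiable_pt_lim_proj1_0 (fun r => r)), derivable_pt_lim_id. }
  assert (D3 : differentiable_pt_lim (fun u _ => a + u) (r * s t) t 1 0).
  { apply (differentiable_pt_lim_proj1_0 (fun u => a + u)).
    replace 1 with (0 + 1) by ring.
    apply (derivable_pt_lim_plus (fun _ => a) (fun u => u));
      [apply derivable_pt_lim_const|apply derivable_pt_lim_id]. }
  pose proof (differentiable_pt_lim_comp (fun u v => u * v) (fun r _ => r) (fun _ t => s t)
    r t _ _ _ _ _ _ (differentiable_pt_lim_mult r (s t)) D2 D1) as D4.
  pose proof (differentiable_pt_lim_comp (fun u _ => a + u) (fun r t => r * s t)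
    (fun _ t => t) r t _ _ _ _ _ _ D3 D4 (differentiable_pt_lim_snd r t)) as D5.
  simpl in D5.
  match type of D5 with differentiable_pt_lim _ _ _ ?p ?q =>
    replace (s t) with p by ring; replace (r * ds) with q by ring end.
  exact D5.
Qed.

(** The Cauchy-Riemann equations in polar coordinates, u_r = (v / r)_theta.
    Dividing v by r puts them in the divergence form required by [goursat]. *)
Lemma polar_cauchy_riemann (g : C -> C) (c : C) (r t : R) :
  0 < r -> differentiable_at g (circle_point c r t) ->
  exists m uy vx,
    differentiable_pt_lim (fun r t => Re (g (circle_point c r t))) r t m uy /\
    differentiable_pt_lim (fun r t => Im (g (circle_point c r t)) / r) r t vx m.
Proof.
  intros Hr (F & d & Hd & HF & H).
  destruct (cauchy_riemann g F _ _ d Hd HF H) as [DU DV].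
  set (z := (fst c + r * cos t, snd c + r * sin t) : C) in *.
  pose proof (differentiable_pt_lim_polar (fst c) r t cos _ (derivable_pt_lim_cos t)) as DX.
  pose proof (differentiable_pt_lim_polar (snd c) r t sin _ (derivable_pt_lim_sin t)) as DY.
  pose proof (differentiable_pt_lim_comp _ _ _ r t _ _ _ _ _ _ DU DX DY) as EU.
  pose proof (differentiable_pt_lim_comp _ _ _ r t _ _ _ _ _ _ DV DX DY) as EV.
  assert (DI : differentiable_pt_lim (fun r _ => / r) r t (- / r ^ 2) 0).
  { apply (differentiable_pt_lim_proj1_0 Rinv).
    apply is_derive_Reals; auto_derive; [lra|]. field; lra. }
  pose proof (differentiable_pt_lim_comp (fun u v => u * v)
     (fun r t => Im (g (circle_point c r t))) (fun r _ => / r) r t _ _ _ _ _ _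
     (differentiable_pt_lim_mult (Im (g z)) (/ r)) EV DI) as EW.
  cbv beta in EU, EW.
  do 3 eexists; split; [exact EU|].
  match type of EW with differentiable_pt_lim _ _ _ ?p ?q =>
    match goal with |- differentiable_pt_lim _ _ _ _ ?m => replace m with q end end.
  - exact EW.
  - field; lra.
Qed.

(** The mean value property, in the form needed for the maximum principle.
    In polar coordinates an annulus around c becomes a rectangle; the two
    sides theta = 0 and theta = 2 pi cancel by periodicity, so Goursat's theorem
    says that the mean of Re g over a circle of radius r does not depend on r.
    As r tends to 0 it tends to Re g(c).  Since c itself is never reached,
    differentiability at the centre is not required, only continuity: this is
    what makes removable singularities harmless later on. *)
Lemma Re_le_of_circle (g : C -> C) (c : C) (rho m : R) :
  0 < rho -> continuous_at g c ->
  (forall z, 0 < Cmod (z - c) <= rho -> differentiable_at g z) ->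
  (forall z, Cmod (z - c) = rho -> Re (g z) <= m) ->
  Re (g c) <= m.
Proof.
  intros Hrho Hc Hd Hm; apply Rnot_lt_le; intros Hlt.
  set (e := (Re (g c) - m) / 2).
  assert (He : 0 < e) by (unfold e; lra).
  destruct (Hc e He) as [d [Hd0 Hcd]].
  set (r0 := Rmin d rho / 2).
  assert (Hmin : 0 < Rmin d rho) by (apply Rmin_pos; assumption).
  pose proof (Rmin_l d rho); pose proof (Rmin_r d rho).
  assert (Hr0 : 0 < r0 < rho /\ r0 < d) by (unfold r0; lra).
  set (U := fun r t => Re (g (circle_point c r t))).
  set (V := fun r t => Im (g (circle_point c r t)) / r).
  pose proof PI_RGT_0 as HPI.
  assert (HCR : forall x y, r0 <= x <= r0 + (rho - r0) -> 0 <= y <= 0 + 2 * PI ->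
     exists m uy vx, differentiable_pt_lim U x y m uy /\
                     differentiable_pt_lim V x y vx m).
  { intros r t Hr _; apply polar_cauchy_riemann; [lra|].
    apply Hd; rewrite Cmod_circle_point; lra. }
  assert (Hflux := goursat U V r0 0 (rho - r0) (2 * PI) ltac:(lra) ltac:(lra) HCR).
  unfold flux in Hflux.
  rewrite (RInt_ext (fun t => V t (0 + 2 * PI) - V t 0) (fun _ => 0)) in Hflux.
  2:{ intros r _; unfold V, circle_point.
      rewrite Rplus_0_l, cos_2PI, sin_2PI, cos_0, sin_0; apply Rminus_diag. }
  rewrite RInt_const in Hflux; unfold scal in Hflux; simpl in Hflux.
  unfold mult in Hflux; simpl in Hflux; rewrite Rmult_0_r, Rminus_0_r in Hflux.
  replace (r0 + (rho - r0)) with rho in Hflux by ring.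
  assert (Hle : RInt (fun t => U rho t - U r0 t) 0 (0 + 2 * PI)
                <= RInt (fun _ => - e) 0 (0 + 2 * PI)).
  { apply RInt_le; [lra| |apply ex_RInt_const|].
    - apply (ex_RInt_minus (V := R_NormedModule));
      apply (ex_RInt_continuous (V := R_CompleteNormedModule)); intros t Ht;
      rewrite Rmin_left, Rmax_right in Ht by lra;
      apply continuity_2d_pt_snd, differentiable_continuity_pt;
      [destruct (HCR rho t) as (a & b & _ & D & _)|destruct (HCR r0 t) as (a & b & _ & D & _)];
      try lra; exists a, b; exact D.
    - intros t _; unfold U.
      assert (T1 : Re (g (circle_point c rho t)) <= m)
        by (apply Hm, Cmod_circle_point; lra).
      assert (T2 : Cmod (g (circle_point c r0 t) - g c) < e)
        by (apply Hcd; rewrite Cmod_circle_point; lra).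
      pose proof (re_le_Cmod (g (circle_point c r0 t) - g c)) as T3.
      apply Rabs_le_between in T3.
      change (Re (g (circle_point c r0 t) - g c)) with
        (Re (g (circle_point c r0 t)) - Re (g c)) in T3.
      unfold e in *; lra. }
  rewrite RInt_const in Hle; unfold scal in Hle; simpl in Hle.
  unfold mult in Hle; simpl in Hle.
  change (U : R -> R -> R_CompleteNormedModule) with U in *.
  assert (0 < 2 * PI * e) by (apply Rmult_lt_0_compat; lra).
  lra.
Qed.

(** * The maximum principle *)

(** Suppose no point of the closed disk is a maximum point.  Call a rectangle
    beaten when one point of the disk has a larger value than all points of
    the disk in that rectangle.  Beaten rectangles glue, by choosing the best of
    four points, and small rectangles are beaten by continuity, so the whole disk
    would be beaten by one of its own points. *)
Lemma disk_maximum (psi : C -> R) (r : R) :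
  0 <= r ->
  (forall z, Cmod z <= r -> forall eps, 0 < eps -> exists d, 0 < d /\
     forall w, Cmod (w - z) < d -> Rabs (psi w - psi z) < eps) ->
  exists c, Cmod c <= r /\ forall z, Cmod z <= r -> psi z <= psi c.
Proof.
  intros Hr Hcont; apply NNPP; intros Hno.
  assert (Hbeat : forall c, Cmod c <= r -> exists z, Cmod z <= r /\ psi c < psi z).
  { intros c Hc; apply NNPP; intros Hn; apply Hno; exists c; split; [assumption|].
    intros z Hz; apply Rnot_lt_le; intros Hlt; apply Hn; exists z; auto. }
  set (P := fun s x y : R => exists z', Cmod z' <= r /\ forall u v,
     x <= u <= x + s * (2 * r) -> y <= v <= y + s * (2 * r) -> Cmod (u, v) <= r ->
     psi (u, v) < psi z').
  assert (HP : P 1 (- r) (- r)).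
  { apply (rectangle_bisection P (- r) (- r) (2 * r) (2 * r)); [lra|lra| |].
    - intros s x y _ _ _ _ _ (z1 & D1 & H1) (z2 & D2 & H2) (z3 & D3 & H3) (z4 & D4 & H4).
      assert (Hmax : forall z w, Cmod z <= r -> Cmod w <= r ->
         exists m, Cmod m <= r /\ psi z <= psi m /\ psi w <= psi m).
      { intros z w Hz Hw; destruct (Rle_dec (psi z) (psi w)).
        - exists w; repeat split; try assumption; lra.
        - exists z; repeat split; try assumption; lra. }
      destruct (Hmax z1 z2 D1 D2) as (m1 & E1 & F1 & F2).
      destruct (Hmax z3 z4 D3 D4) as (m2 & E2 & F3 & F4).
      destruct (Hmax m1 m2 E1 E2) as (m3 & E3 & F5 & F6).
      exists m3; split; [assumption|]; intros u v Hu Hv Huv.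
      assert (Es : s * (2 * r) = s / 2 * (2 * r) + s / 2 * (2 * r)) by field.
      destruct (Rle_dec u (x + s / 2 * (2 * r))), (Rle_dec v (y + s / 2 * (2 * r))).
      + assert (psi (u, v) < psi z1) by (apply H1; lra); lra.
      + assert (psi (u, v) < psi z3) by (apply H3; lra); lra.
      + assert (psi (u, v) < psi z2) by (apply H2; lra); lra.
      + assert (psi (u, v) < psi z4) by (apply H4; lra); lra.
    - intros a b _ _.
      assert (Hnear : forall d, 0 < d -> exists delta, 0 < delta /\ forall s x y u v,
         0 < s < delta -> x <= a <= x + s * (2 * r) -> y <= b <= y + s * (2 * r) ->
         x <= u <= x + s * (2 * r) -> y <= v <= y + s * (2 * r) ->
         Cmod ((u, v) - (a, b)) < d).
      { intros d Hd; set (delta := d / (2 * (2 * r + 1))).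
        assert (Hdel : delta * (2 * r + 1) = d / 2) by (unfold delta; field; lra).
        exists delta; split; [unfold delta; apply Rdiv_lt_0_compat; lra|].
        intros s x y u v Hs Ha Hb Hu Hv.
        pose proof (Cmod_le_2_Rmax ((u, v) - (a, b))) as T.
        change (fst ((u, v) - (a, b))%C) with (u - a) in T.
        change (snd ((u, v) - (a, b))%C) with (v - b) in T.
        set (M := Rmax (Rabs (u - a)) (Rabs (v - b))) in *.
        assert (HM : M <= s * (2 * r)) by (apply Rmax_lub; apply Rabs_le; lra).
        assert (HM0 : 0 <= M) by (eapply Rle_trans; [apply Rabs_pos|apply Rmax_l]).
        assert (s * (2 * r) <= s * (2 * r + 1)) by nra.
        assert (s * (2 * r + 1) < delta * (2 * r + 1)) by (apply Rmult_lt_compat_r; lra).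
        nra. }
      destruct (Rle_dec (Cmod (a, b)) r) as [Hin|Hout].
      + destruct (Hbeat _ Hin) as (z' & Hz' & Hlt).
        destruct (Hcont _ Hin (psi z' - psi (a, b)) ltac:(lra)) as (d & Hd & Hpsi).
        destruct (Hnear d Hd) as (delta & Hdelta & Hn).
        exists delta; split; [assumption|].
        intros s x y Hs _ _ _ _ _ Ha Hb; exists z'; split; [assumption|].
        intros u v Hu Hv _.
        specialize (Hpsi (u, v) (Hn s x y u v Hs Ha Hb Hu Hv)).
        apply Rabs_lt_between in Hpsi; lra.
      (* Near a point outside the closed disk the condition is vacuous. *)
      + destruct (Hnear (Cmod (a, b) - r) ltac:(lra)) as (delta & Hdelta & Hn).
        exists delta; split; [assumption|].
        intros s x y Hs _ _ _ _ _ Ha Hb; exists (RtoC 0); split; [rewrite Cmod_0; lra|].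
        intros u v Hu Hv Huv; exfalso.
        pose proof (Hn s x y u v Hs Ha Hb Hu Hv) as T.
        pose proof (Cmod_reverse_triangle (a, b) (u, v)) as T'.
        rewrite Cmod_minus_sym in T'; lra. }
  destruct HP as (z' & Hz' & H).
  specialize (H (fst z') (snd z')).
  rewrite <- surjective_pairing in H.
  pose proof (Rmax_Cmod z') as T.
  pose proof (Rmax_l (Rabs (fst z')) (Rabs (snd z'))).
  pose proof (Rmax_r (Rabs (fst z')) (Rabs (snd z'))).
  assert (T1 : Rabs (fst z') <= r) by lra.
  assert (T2 : Rabs (snd z') <= r) by lra.
  apply Rabs_le_between in T1, T2.
  specialize (H ltac:(lra) ltac:(lra) Hz'); lra.
Qed.

(** Holomorphic up to isolated points where only continuity is required.  By
    Riemann's theorem these are just the holomorphic functions, but the class is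
    stable under division by z - q at a zero q without appealing to that
    theorem, and the maximum principle can be proved directly for it. *)
Definition regular_on_disk (g : C -> C) : Prop :=
  forall z, unit_disk z -> continuous_at g z /\
    exists rho, 0 < rho /\ forall w, 0 < Cmod (w - z) < rho -> differentiable_at g w.

Lemma Cmod_sqr_plus (z w : C) :
  Cmod (z + w) ^ 2 = Cmod z ^ 2 + 2 * Re (Cconj z * w) + Cmod w ^ 2.
Proof. rewrite !Cmod2_alt; unfold Re, Im; simpl; ring. Qed.

Lemma unit_direction (a : C) : exists e : C, Cmod e = 1 /\ (e * a)%C = RtoC (Cmod a).
Proof.
  destruct (excluded_middle_informative (a = 0)) as [->|Ha].
  - exists 1%C; rewrite Cmod_1, Cmod_0; split; [reflexivity|ring].
  - apply Cmod_gt_0 in Ha as Hp.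
    assert (Hne : RtoC (Cmod a) <> 0) by (intros E; apply RtoC_inj in E; lra).
    exists (Cconj a / RtoC (Cmod a))%C; split.
    + rewrite Cmod_div, Cmod_conj, Cmod_R, Rabs_pos_eq by (assumption || lra).
      field; lra.
    + replace (Cconj a / Cmod a * a)%C with (a * Cconj a / Cmod a)%C by (field; assumption).
      rewrite <- Cmod2_conj, RtoC_pow; field; assumption.
Qed.

(** If the bound failed, |g| + eps |z|^2 would for small eps take its maximum
    over the disk at an interior point c.  On a small circle of radius rho around
    c, |z|^2 equals |c|^2 + rho^2 plus the harmonic function
    2 Re (conj c (z - c)).  Adding to a rotation of g the corresponding
    holomorphic function therefore gives a function whose real part on the circle
    is at most |g(c)| - eps rho^2 but is |g(c)| at the centre, against the
    mean value property.  The term in eps replaces the usual discussion of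
    the case of equality. *)
Lemma maximum_modulus (g : C -> C) (r M : R) :
  0 <= r < 1 -> regular_on_disk g ->
  (forall z, Cmod z = r -> Cmod (g z) <= M) ->
  forall z, Cmod z <= r -> Cmod (g z) <= M.
Proof.
  intros Hr Hg HM z0 Hz0; apply Rnot_lt_le; intros Hlt.
  set (eps := (Cmod (g z0) - M) / 2).
  assert (Heps : 0 < eps) by (unfold eps; lra).
  set (psi := fun z => Cmod (g z) + eps * Cmod z ^ 2).
  destruct (disk_maximum psi r) as (c & Hc & Hmax); [lra| |].
  { intros z Hz e He.
    destruct (Hg z) as [Cg _]; [unfold unit_disk; lra|].
    destruct (Cg (e / 2) ltac:(lra)) as (d1 & Hd1 & H1).
    assert (Hd2 : 0 < e / (8 * eps)) by (apply Rdiv_lt_0_compat; lra).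
    exists (Rmin d1 (Rmin 1 (e / (8 * eps)))); split.
    { repeat apply Rmin_pos; lra. }
    intros w Hw.
    pose proof (Rmin_l d1 (Rmin 1 (e / (8 * eps)))).
    pose proof (Rmin_r d1 (Rmin 1 (e / (8 * eps)))).
    pose proof (Rmin_l 1 (e / (8 * eps))); pose proof (Rmin_r 1 (e / (8 * eps))).
    specialize (H1 w ltac:(lra)).
    pose proof (Cmod_reverse_triangle (g w) (g z)).
    pose proof (Cmod_reverse_triangle (g z) (g w)) as T.
    rewrite Cmod_minus_sym in T.
    pose proof (Cmod_reverse_triangle w z).
    pose proof (Cmod_reverse_triangle z w) as T'.
    rewrite Cmod_minus_sym in T'.
    pose proof (Cmod_ge_0 z); pose proof (Cmod_ge_0 w).
    assert (E1 : eps * Cmod (w - z) <= e / 8).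
    { apply Rle_trans with (eps * (e / (8 * eps))).
      - apply Rmult_le_compat_l; lra.
      - right; field; lra. }
    pose proof (Cmod_ge_0 (w - z)).
    unfold psi.
    assert (Hq : Rabs (eps * Cmod w ^ 2 - eps * Cmod z ^ 2) <= 3 * (e / 8)).
    { replace (eps * Cmod w ^ 2 - eps * Cmod z ^ 2)
        with ((eps * (Cmod w - Cmod z)) * (Cmod w + Cmod z)) by ring.
      rewrite Rabs_mult, (Rabs_pos_eq (Cmod w + Cmod z)) by lra.
      rewrite Rmult_comm; apply Rmult_le_compat; try lra; try apply Rabs_pos.
      rewrite Rabs_mult, Rabs_pos_eq by lra.
      apply Rle_trans with (eps * Cmod (w - z)); [|assumption].
      apply Rmult_le_compat_l; [lra|]; apply Rabs_le; lra. }
    apply Rabs_le_between in Hq; apply Rabs_lt_between; lra. }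
  assert (Hz0' := Hmax z0 Hz0); unfold psi in Hz0'.
  pose proof (pow2_ge_0 (Cmod z0)).
  assert (0 <= eps * Cmod z0 ^ 2) by (apply Rmult_le_pos; lra).
  pose proof (Cmod_ge_0 c).
  assert (Hcr : Cmod c < r).
  { destruct Hc as [|E]; [assumption|exfalso].
    specialize (HM c E).
    assert (eps * Cmod c ^ 2 <= eps * 1) by (apply Rmult_le_compat_l; [lra|rewrite E; nra]).
    unfold eps in *; lra. }
  destruct (Hg c) as [Cg (rho0 & Hrho0 & Dg)]; [unfold unit_disk; lra|].
  set (rho := Rmin (rho0 / 2) (r - Cmod c)).
  assert (Hrho : 0 < rho) by (apply Rmin_pos; lra).
  assert (rho <= rho0 / 2) by apply Rmin_l.
  assert (rho <= r - Cmod c) by apply Rmin_r.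
  destruct (unit_direction (g c)) as (e & He & Hec).
  set (G := fun z => (e * g z + 2 * eps * Cconj c * (z + - c))%C).
  assert (HG : Re (G c) <= Cmod (g c) - eps * rho ^ 2).
  { apply (Re_le_of_circle G c rho); [assumption| | |].
    - apply continuous_at_plus; apply continuous_at_mult; auto using continuous_at_const, continuous_at_plus, continuous_at_id.
    - intros z Hz; apply differentiable_at_plus; apply differentiable_at_mult;
        auto using differentiable_at_const, differentiable_at_plus, differentiable_at_id.
      apply Dg; lra.
    - intros z Hz.
      assert (Hzr : Cmod z <= r).
      { pose proof (Cmod_triangle (z - c) c) as T.
        replace (z - c + c)%C with z in T by ring; lra. }
      specialize (Hmax z Hzr); unfold psi in Hmax.
      pose proof (Cmod_sqr_plus c (z - c)) as E.
      replace (c + (z - c))%C with z in E by ring; rewrite Hz in E.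
      assert (ER : Re (G z) = Re (e * g z)%C + 2 * eps * Re (Cconj c * (z - c))%C).
      { unfold G, Re, Im; simpl; ring. }
      pose proof (re_le_Cmod (e * g z)) as T; rewrite Cmod_mult, He in T.
      apply Rabs_le_between in T.
      rewrite E in Hmax; lra. }
  assert (EG : Re (G c) = Cmod (g c)).
  { unfold G; rewrite Hec; unfold Re, Im; simpl; ring. }
  assert (0 < eps * rho ^ 2) by (apply Rmult_lt_0_compat; [assumption|nra]).
  lra.
Qed.

(** * The Schwarz-Pick lemma *)

Lemma moebius_identity (a z : C) :
  Cmod (1 - Cconj a * z) ^ 2 - Cmod (z - a) ^ 2 = (1 - Cmod a ^ 2) * (1 - Cmod z ^ 2).
Proof. rewrite !Cmod2_alt; unfold Re, Im; simpl; ring. Qed.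

Lemma one_minus_conj_mult_bound (a z : C) :
  unit_disk z -> 1 - Cmod a <= Cmod (1 - Cconj a * z).
Proof.
  intros Hz; unfold unit_disk in Hz.
  pose proof (Cmod_reverse_triangle 1 (Cconj a * z)) as T.
  rewrite Cmod_1, Cmod_mult, Cmod_conj in T.
  pose proof (Cmod_ge_0 a); pose proof (Cmod_ge_0 z); nra.
Qed.

Lemma one_minus_conj_mult_neq_0 (a z : C) :
  unit_disk a -> unit_disk z -> (1 - Cconj a * z)%C <> 0.
Proof.
  intros Ha Hz; pose proof (one_minus_conj_mult_bound a z Hz).
  unfold unit_disk in Ha; apply Cmod_gt_0; lra.
Qed.

(** The Schwarz-Pick lemma at q: the quotient of g by the disk automorphism
    (z - q) / (1 - conj q z) is bounded by 1, because that automorphism has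
    modulus close to 1 near the unit circle.  The quotient is kept, not only the
    inequality, since the boundary behaviour of this quotient is what matters. *)
Lemma schwarz_pick_quotient (g : C -> C) (q : C) :
  unit_disk q -> regular_on_disk g ->
  (forall z, unit_disk z -> Cmod (g z) <= 1) ->
  differentiable_at g q -> g q = 0 ->
  exists k, regular_on_disk k /\
    (forall z, unit_disk z -> Cmod (k z) <= 1) /\
    (forall z, (g z * (1 - Cconj q * z) = k z * (z - q))%C) /\
    (forall z, z <> q -> differentiable_at g z -> differentiable_at k z).
Proof.
  intros Hq Hg Hg1 (F & d & Hd & HF & H) Hgq.
  set (k := fun z => if excluded_middle_informative (z = q)
     then (F q * (1 + - Cconj q * q))%C
     else (g z * (1 + - Cconj q * z) * / (z + - q))%C).
  assert (Hne : forall z, z <> q -> (z - q)%C <> 0).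
  { intros z Hz E; apply Hz; replace z with (z - q + q)%C by ring; rewrite E; ring. }
  assert (Hfar : forall z w, z <> q -> Cmod (w - z) < Cmod (z - q) -> w <> q).
  { intros z w Hz Hw ->; rewrite Cmod_minus_sym in Hw; lra. }
  assert (Hloc : forall z, z <> q -> forall w, Cmod (w - z) < Cmod (z - q) ->
     (g w * (1 + - Cconj q * w) * / (w + - q))%C = k w).
  { intros z Hz w Hw; unfold k; destruct excluded_middle_informative as [E|]; [|reflexivity].
    exfalso; exact (Hfar z w Hz Hw E). }
  assert (Hkd : forall z, z <> q -> differentiable_at g z -> differentiable_at k z).
  { intros z Hz Dz; apply (differentiable_at_ext_loc _ _ z (Cmod (z - q))) with (2 := Hloc z Hz).
    - apply Cmod_gt_0, Hne, Hz.
    - apply differentiable_at_mult; [apply differentiable_at_mult; [assumption|]|apply differentiable_at_inv; [exact (Hne z Hz)|]];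
        auto using differentiable_at_plus, differentiable_at_mult, differentiable_at_const, differentiable_at_id. }
  assert (Hkc : forall z, continuous_at g z -> continuous_at k z).
  { intros z Cz; destruct (excluded_middle_informative (z = q)) as [->|Hz].
    - apply (continuous_at_ext_loc (fun w => F w * (1 + - Cconj q * w))%C _ q d); [assumption| |].
      + intros w Hw; unfold k; destruct excluded_middle_informative as [->|Hwq]; [reflexivity|].
        specialize (H w Hw); rewrite Hgq in H.
        replace (g w) with (F w * (w - q))%C by (rewrite <- H; ring).
        field; exact (Hne w Hwq).
      + apply continuous_at_mult; auto using continuous_at_plus, continuous_at_mult, continuous_at_const, continuous_at_id.
    - apply (continuous_at_ext_loc _ _ z (Cmod (z - q))) with (2 := Hloc z Hz).
      + apply Cmod_gt_0, Hne, Hz.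
      + apply continuous_at_mult; [apply continuous_at_mult; [assumption|]|apply continuous_at_inv; [exact (Hne z Hz)|]];
        auto using continuous_at_plus, continuous_at_mult, continuous_at_const, continuous_at_id. }
  assert (Hmul : forall z, (g z * (1 - Cconj q * z) = k z * (z - q))%C).
  { intros z; unfold k; destruct excluded_middle_informative as [->|Hz].
    - rewrite Hgq; ring.
    - field; exact (Hne z Hz). }
  assert (Hk : regular_on_disk k).
  { intros z Hz; destruct (Hg z Hz) as [Cz (rho & Hrho & Dz)].
    split; [apply Hkc; assumption|].
    destruct (excluded_middle_informative (z = q)) as [->|Hzq].
    - exists rho; split; [assumption|]; intros w Hw; apply Hkd; [|apply Dz; assumption].
      intros ->; rewrite Cminus_diag, Cmod_0 in Hw; lra.
    - exists (Rmin rho (Cmod (z - q))); split.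
      { apply Rmin_pos; [assumption|apply Cmod_gt_0, Hne, Hzq]. }
      pose proof (Rmin_l rho (Cmod (z - q))); pose proof (Rmin_r rho (Cmod (z - q))).
      intros w Hw; apply Hkd; [apply (Hfar z); [assumption|lra]|apply Dz; lra]. }
  exists k; repeat split; try assumption; try (apply Hk; assumption).
  intros z0 Hz0; apply le_epsilon; intros eps Heps.
  unfold unit_disk in Hz0, Hq.
  pose proof (Cmod_ge_0 z0); pose proof (Cmod_ge_0 q).
  set (m := Rmax (Cmod z0) (Cmod q)).
  assert (Hm : m < 1) by (apply Rmax_lub_lt; assumption).
  assert (Cmod z0 <= m) by apply Rmax_l.
  assert (Cmod q <= m) by apply Rmax_r.
  set (e := Rmin 1 eps).
  assert (He : 0 < e) by (apply Rmin_pos; lra).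
  assert (e <= 1) by apply Rmin_l.
  assert (e <= eps) by apply Rmin_r.
  (* On the circle |z| = 1 - s the quotient is at most
     1 + (1 - |z|^2) / |z - q|, where |z - q| >= (1 - m) / 2; the choice of [s]
     makes this at most 1 + e. *)
  set (s := (1 - m) / 4 * e).
  assert (Hs : 0 < s) by (unfold s; apply Rmult_lt_0_compat; lra).
  assert (Hs1 : s <= (1 - m) / 4) by (unfold s; nra).
  apply Rle_trans with (1 + e); [|lra].
  apply (maximum_modulus k (1 - s)); [lra|assumption| |lra].
  intros z Hz.
  assert (Dz : unit_disk z) by (unfold unit_disk; lra).
  specialize (Hmul z); apply (f_equal Cmod) in Hmul; rewrite !Cmod_mult in Hmul.
  specialize (Hg1 z Dz).
  pose proof (Cmod_reverse_triangle z q) as T1.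
  assert (T2 : Cmod (1 - Cconj q * z) <= (1 - Cmod z ^ 2) + Cmod z * Cmod (z - q)).
  { replace (1 - Cconj q * z)%C
      with (RtoC (1 - Cmod z ^ 2) + z * (Cconj (z - q)))%C.
    - eapply Rle_trans; [apply Cmod_triangle|].
      rewrite Cmod_mult, Cmod_conj, Cmod_R, Rabs_pos_eq; [lra|rewrite Hz; nra].
    - rewrite RtoC_minus, Cmod2_conj, Cminus_conj; ring. }
  pose proof (Cmod_ge_0 (1 - Cconj q * z)).
  pose proof (Cmod_ge_0 (k z)).
  assert (T3 : Cmod (k z) * Cmod (z - q) <= (1 - Cmod z ^ 2) + Cmod z * Cmod (z - q)) by nra.
  rewrite Hz in T1, T3.
  assert (T4 : (1 - m) / 2 <= Cmod (z - q)) by lra.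
  assert (T5 : 1 - (1 - s) ^ 2 <= e * Cmod (z - q)).
  { apply Rle_trans with (2 * s); [nra|].
    apply Rle_trans with (e * ((1 - m) / 2)); [unfold s; lra|].
    apply Rmult_le_compat_l; lra. }
  apply Rmult_le_reg_r with (Cmod (z - q)); [lra|]. nra.
Qed.

(** * Rigidity at a boundary point *)

(** A form of Hopf's lemma.  The function k = 1 - h has nonnegative real part,
    and a positive harmonic function decays at most linearly at the boundary.
    If Re k(q) > 0, the Cayley transform w = (k - a) / (k + conj a) with a = k(q)
    maps the disk into the closed unit disk and vanishes at q, so Schwarz-Pick
    bounds |w(r)| by the modulus of a disk automorphism, whose distance to 1 is
    at least a multiple of 1 - r.  But 1 - |w(r)|^2 is of the order of Re k(r), which is
    at most eta * (1 - r) for arbitrarily small eta. *)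
Lemma boundary_one_uniqueness (h : C -> C) :
  regular_on_disk h -> (forall z, unit_disk z -> Cmod (h z) <= 1) ->
  (forall eta, 0 < eta -> exists r : R, 0 <= r < 1 /\ Cmod (1 - h (RtoC r)) <= eta * (1 - r)) ->
  forall q, unit_disk q -> differentiable_at h q -> h q = 1.
Proof.
  intros Hh Hh1 Hb q Hq Dq.
  pose proof (Hh1 q Hq) as Hq1.
  assert (HRe : forall z, unit_disk z -> 0 <= Re (1 - h z)).
  { intros z Hz; specialize (Hh1 z Hz); pose proof (re_le_Cmod (h z)) as T.
    apply Rabs_le_between in T; change (Re (1 - h z)) with (1 - Re (h z)); lra. }
  set (a := (1 - h q)%C).
  destruct (HRe q Hq) as [Ha|Ha].
  2:{ change (0 = 1 - Re (h q)) in Ha.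
      pose proof (Cmod2_alt (h q)) as E.
      assert (Re (h q) = 1) by lra.
      assert (Im (h q) = 0).
      { assert (Im (h q) ^ 2 <= 0) by (pose proof (Cmod_ge_0 (h q)); nra). nra. }
      rewrite (surjective_pairing (h q)).
      unfold RtoC; f_equal; assumption. }
  exfalso; fold a in Ha.
  set (w := fun z => ((1 + - h z + - a) * / (1 + - h z + Cconj a))%C).
  assert (Hden : forall z, unit_disk z -> Re a <= Cmod (1 + - h z + Cconj a)).
  { intros z Hz; eapply Rle_trans; [|apply re_le_Cmod].
    eapply Rle_trans; [|apply Rle_abs].
    change (Re (1 + - h z + Cconj a)) with (Re (1 - h z) + Re a).
    specialize (HRe z Hz); lra. }
  assert (Hden0 : forall z, unit_disk z -> (1 + - h z + Cconj a)%C <> 0).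
  { intros z Hz; apply Cmod_gt_0; specialize (Hden z Hz); lra. }
  assert (Hdw : forall z, unit_disk z -> differentiable_at h z -> differentiable_at w z).
  { intros z Hz Dz.
    assert (D1 : differentiable_at (fun z => 1 + - h z)%C z).
    { apply differentiable_at_ext_loc with (fun z => 1 + - 1 * h z)%C 1; [lra|intros; ring|].
      auto using differentiable_at_plus, differentiable_at_mult, differentiable_at_const. }
    apply differentiable_at_mult; [|apply differentiable_at_inv; [apply Hden0; assumption|]];
      auto using differentiable_at_plus, differentiable_at_const. }
  assert (Hw : regular_on_disk w).
  { intros z Hz; destruct (Hh z Hz) as [Cz (rho & Hrho & Dz)]; split.
    - assert (D1 : continuous_at (fun z => 1 + - h z)%C z).
      { apply continuous_at_ext_loc with (fun z => 1 + - 1 * h z)%C 1; [lra|intros; ring|].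
        auto using continuous_at_plus, continuous_at_mult, continuous_at_const. }
      apply continuous_at_mult; [|apply continuous_at_inv; [apply Hden0; assumption|]];
        auto using continuous_at_plus, continuous_at_const.
    - unfold unit_disk in Hz.
      exists (Rmin rho (1 - Cmod z)); split; [apply Rmin_pos; lra|].
      pose proof (Rmin_l rho (1 - Cmod z)); pose proof (Rmin_r rho (1 - Cmod z)).
      intros v Hv; apply Hdw; [|apply Dz; lra].
      pose proof (Cmod_reverse_triangle v z); unfold unit_disk; lra. }
  assert (Hid : forall k : C, Cmod (k + - a) ^ 2 = Cmod (k + Cconj a) ^ 2 - 4 * Re k * Re a).
  { intros k; rewrite !Cmod2_alt; unfold Re, Im; simpl; ring. }
  assert (Hw1 : forall z, unit_disk z -> Cmod (w z) <= 1).
  { intros z Hz; unfold w.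
    rewrite Cmod_mult, Cmod_inv by (apply Hden0; assumption).
    specialize (Hden z Hz); specialize (HRe z Hz); specialize (Hid (1 + - h z)%C).
    change (Re (1 + - h z)) with (Re (1 - h z)) in Hid.
    apply (Rle_div_l _ 1); [lra|]; rewrite Rmult_1_l.
    apply Rsqr_incr_0_var; [rewrite !Rsqr_pow2; nra|apply Cmod_ge_0]. }
  assert (Hwq : w q = 0) by (unfold w, a; field; exact (Hden0 q Hq)).
  destruct (schwarz_pick_quotient w q Hq Hw Hw1 (Hdw q Hq Dq) Hwq) as (K & _ & HK1 & HK & _).
  unfold unit_disk in Hq.
  (* Half of the threshold above which the estimates below are compatible. *)
  set (eta := Re a * (1 - Cmod q ^ 2) / 32).
  assert (Hq2 : 0 < 1 - Cmod q ^ 2) by (pose proof (Cmod_ge_0 q); nra).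
  assert (Heta : 0 < eta) by (unfold eta; apply Rdiv_lt_0_compat; [|lra];
    apply Rmult_lt_0_compat; assumption).
  destruct (Hb eta Heta) as (r & Hr & Hrh).
  assert (Dr : unit_disk (RtoC r)) by (unfold unit_disk; rewrite Cmod_R, Rabs_pos_eq; lra).
  specialize (HK (RtoC r)); specialize (HK1 _ Dr).
  assert (Hmul : ((1 + - h r + - a) * (1 - Cconj q * r)
                  = K r * (r - q) * (1 + - h r + Cconj a))%C).
  { rewrite <- HK; unfold w; field; exact (Hden0 _ Dr). }
  apply (f_equal Cmod) in Hmul; rewrite !Cmod_mult in Hmul.
  pose proof (Hid (1 + - h r)%C) as I1.
  change (Re (1 + - h r)) with (Re (1 - h r)) in I1.
  pose proof (moebius_identity q r) as I2.
  rewrite (Cmod_R r), Rabs_pos_eq in I2 by lra.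
  pose proof (HRe _ Dr) as Hk0; pose proof (Hden _ Dr) as HA.
  pose proof (re_le_Cmod (1 - h r)) as Hk1; apply Rabs_le_between in Hk1.
  assert (HB : Cmod (1 - Cconj q * r) <= 2).
  { unfold Cminus; eapply Rle_trans; [apply Cmod_triangle|].
    rewrite Cmod_1, Cmod_opp, Cmod_mult, Cmod_conj, Cmod_R, Rabs_pos_eq by lra.
    pose proof (Cmod_ge_0 q); nra. }
  pose proof (Cmod_ge_0 (1 - Cconj q * r)) as HB0.
  set (A := Cmod (1 + - h r + Cconj a)) in *.
  set (B := Cmod (1 - Cconj q * r)) in *.
  set (x := Cmod (1 + - h r + - a)) in *.
  set (y := Cmod (r - q)) in *.
  set (k := Re (1 - h r)) in *.
  assert (Hx0 : 0 <= x) by apply Cmod_ge_0.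
  assert (Hy0 : 0 <= y) by apply Cmod_ge_0.
  assert (HK0 : 0 <= Cmod (K r)) by apply Cmod_ge_0.
  assert (J1 : x * B <= y * A).
  { rewrite Hmul, Rmult_assoc; rewrite <- (Rmult_1_l (y * A)) at 2.
    apply Rmult_le_compat_r; [apply Rmult_le_pos; lra|assumption]. }
  assert (J2 : x ^ 2 * B ^ 2 <= y ^ 2 * A ^ 2).
  { rewrite <- !Rpow_mult_distr; apply pow_incr; split; [|assumption].
    apply Rmult_le_pos; assumption. }
  assert (J3 : A ^ 2 * ((1 - Cmod q ^ 2) * (1 - r ^ 2)) <= 4 * k * Re a * B ^ 2).
  { rewrite I1 in J2; replace (y ^ 2) with (B ^ 2 - (1 - Cmod q ^ 2) * (1 - r ^ 2)) in J2 by lra.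
    lra. }
  assert (J4 : Re a ^ 2 * ((1 - Cmod q ^ 2) * (1 - r))
               <= A ^ 2 * ((1 - Cmod q ^ 2) * (1 - r ^ 2))).
  { apply Rmult_le_compat; [nra|apply Rmult_le_pos; lra|nra|].
    apply Rmult_le_compat_l; [lra|nra]. }
  assert (J5 : 4 * k * Re a * B ^ 2 <= 4 * (eta * (1 - r)) * Re a * 4).
  { apply Rmult_le_compat; [|nra| |nra].
    - apply Rmult_le_pos; lra.
    - apply Rmult_le_compat_r; lra. }
  assert (J6 : Re a ^ 2 * ((1 - Cmod q ^ 2) * (1 - r))
               = 2 * (4 * (eta * (1 - r)) * Re a * 4)) by (unfold eta; field).
  assert (0 < 4 * (eta * (1 - r)) * Re a * 4).
  { repeat apply Rmult_lt_0_compat; lra. }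
  lra.
Qed.

Lemma nontangential_radial (g h : C -> C) (eps : R) :
  little_o_nontangential_at_1 g h -> 0 < eps ->
  exists d, 0 < d /\ forall r : R, 0 < r < 1 -> 1 - r < d ->
    Cmod (g (RtoC r) / h (RtoC r)) < eps.
Proof.
  intros Hgh Heps.
  assert (He2 : 0 < eps / 2) by lra.
  destruct (Hgh 2 ltac:(lra) (fun w => Cmod w < eps)) as [d Hd].
  { exists (mkposreal _ He2); intros w Hw.
    destruct Hw as [H1 H2]; simpl in H1, H2.
    eapply Rle_lt_trans; [apply Cmod_le_2_Rmax|].
    unfold ball in H1, H2; simpl in H1, H2.
    unfold AbsRing_ball, abs, minus, plus, opp in H1, H2; simpl in H1, H2.
    rewrite Ropp_0, Rplus_0_r in H1, H2.
    assert (HM : Rmax (Rabs (fst w)) (Rabs (snd w)) < eps / 2) by (apply Rmax_lub_lt; assumption).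
    lra. }
  exists d; split; [apply cond_pos|]; intros r Hr Hrd.
  apply (Hd (RtoC r)).
  - split; simpl; unfold ball; simpl; unfold AbsRing_ball, abs, minus, plus, opp; simpl.
    + rewrite Rabs_left; lra.
    + rewrite Ropp_0, Rplus_0_r, Rabs_R0; apply cond_pos.
  - unfold stolz_region, unit_disk.
    rewrite <- RtoC_minus, !Cmod_R, (Rabs_pos_eq r), Rabs_left by lra; lra.
Qed.

(* A self-map of the disk is represented by a function on C of which only the
   values on the disk matter. *)
Theorem corollary2p5 (f : C -> C)
  (f_maps : forall z : C, unit_disk z -> unit_disk (f z))
  (f_hol : holomorphic_on unit_disk f)
  (f_bdry : little_o_nontangential_at_1
              (fun z : C => (f z - z)%C) (fun z : C => (z - 1)%C))
  (f_fix : exists p : C, unit_disk p /\ f p = p) :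
  forall z : C, unit_disk z -> f z = z.
Proof.
  destruct f_fix as (p & Hp & Hfp).
  set (g := fun z => ((f z + - p) * / (1 + - Cconj p * f z))%C).
  assert (Hden : forall z, unit_disk z -> (1 + - Cconj p * f z)%C <> 0).
  { intros z Hz E; apply (one_minus_conj_mult_neq_0 p (f z) Hp (f_maps z Hz)).
    rewrite <- E; ring. }
  assert (Dg : forall z, unit_disk z -> differentiable_at g z).
  { intros z Hz; pose proof (ex_derive_differentiable_at f z (f_hol z Hz)) as Df.
    apply differentiable_at_mult; [|apply differentiable_at_inv; [apply Hden; assumption|]];
      auto using differentiable_at_plus, differentiable_at_mult, differentiable_at_const. }
  assert (Hg : regular_on_disk g).
  { intros z Hz; split; [apply differentiable_at_continuous_at, Dg, Hz|].
    unfold unit_disk in Hz; exists (1 - Cmod z); split; [lra|]; intros w Hw; apply Dg.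
    pose proof (Cmod_reverse_triangle w z); unfold unit_disk; lra. }
  assert (Hg1 : forall z, unit_disk z -> Cmod (g z) <= 1).
  { intros z Hz; unfold g.
    pose proof (f_maps z Hz) as Hfz.
    rewrite Cmod_mult, Cmod_inv by (apply Hden; assumption).
    pose proof (moebius_identity p (f z)) as I.
    replace (1 - Cconj p * f z)%C with (1 + - Cconj p * f z)%C in I by ring.
    change (f z - p)%C with (f z + - p)%C in I.
    pose proof (proj1 (Cmod_gt_0 _) (Hden z Hz)) as Hpos.
    apply (Rle_div_l _ 1); [lra|]; rewrite Rmult_1_l.
    unfold unit_disk in Hp, Hfz; pose proof (Cmod_ge_0 p); pose proof (Cmod_ge_0 (f z)).
    apply Rsqr_incr_0_var; [|apply Cmod_ge_0]; rewrite !Rsqr_pow2.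
    assert (0 <= (1 - Cmod p ^ 2) * (1 - Cmod (f z) ^ 2)) by (apply Rmult_le_pos; nra).
    lra. }
  assert (Hgp : g p = 0).
  { unfold g; rewrite Hfp; field.
    intros E; apply (Hden p Hp); rewrite Hfp, <- E; ring. }
  destruct (schwarz_pick_quotient g p Hp Hg Hg1 (Dg p Hp) Hgp) as (h & Hh & Hh1 & Hgh & Dh).
  (* 1 - h is, up to factors bounded away from 0 near 1, the displacement of f. *)
  assert (Hkey : forall z, unit_disk z ->
    ((1 - h z) * (z - p) * (1 - Cconj p * f z) = (z - f z) * (1 - Cconj p * p))%C).
  { intros z Hz.
    replace ((1 - h z) * (z - p) * (1 - Cconj p * f z))%C
      with ((z - p) * (1 - Cconj p * f z) - h z * (z - p) * (1 - Cconj p * f z))%C by ring.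
    rewrite <- Hgh; unfold g; field; exact (Hden z Hz). }
  pose proof Hp as Hp'; unfold unit_disk in Hp'; pose proof (Cmod_ge_0 p).
  assert (Hradial : forall eta, 0 < eta ->
     exists r : R, 0 <= r < 1 /\ Cmod (1 - h (RtoC r)) <= eta * (1 - r)).
  { intros eta Heta.
    set (b := (1 - Cmod p) ^ 2 / 2).
    assert (Hb : 0 < b) by (unfold b; nra).
    destruct (nontangential_radial _ _ (eta * b) f_bdry) as (d & Hd & Hr).
    { apply Rmult_lt_0_compat; assumption. }
    set (s := Rmin (d / 2) ((1 - Cmod p) / 2)).
    assert (Hs : 0 < s) by (apply Rmin_pos; lra).
    assert (s <= d / 2) by apply Rmin_l.
    assert (s <= (1 - Cmod p) / 2) by apply Rmin_r.
    exists (1 - s); split; [lra|].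
    specialize (Hr (1 - s) ltac:(lra) ltac:(lra)).
    assert (Dr : unit_disk (RtoC (1 - s))) by (unfold unit_disk; rewrite Cmod_R, Rabs_pos_eq; lra).
    set (z := RtoC (1 - s)) in *.
    assert (Ez : Cmod (z - 1) = s).
    { unfold z; rewrite <- RtoC_minus, Cmod_R, Rabs_left; lra. }
    assert (Hz1 : (z - 1)%C <> 0) by (apply Cmod_gt_0; lra).
    rewrite Cmod_div, Ez in Hr by assumption.
    apply (proj1 (Rlt_div_l _ _ _ Hs)) in Hr.
    rewrite Cmod_minus_sym in Hr.
    specialize (Hkey z Dr); apply (f_equal Cmod) in Hkey; rewrite !Cmod_mult in Hkey.
    assert (L1 : (1 - Cmod p) / 2 <= Cmod (z - p)).
    { pose proof (Cmod_reverse_triangle z p) as T.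
      unfold z in T at 1; rewrite Cmod_R, Rabs_pos_eq in T; lra. }
    pose proof (one_minus_conj_mult_bound p (f z) (f_maps z Dr)) as L2.
    assert (L3 : Cmod (1 - Cconj p * p) <= 1).
    { replace (1 - Cconj p * p)%C with (RtoC (1 - Cmod p ^ 2)).
      - pose proof (pow_incr (Cmod p) 1 2 ltac:(lra)); pose proof (pow2_ge_0 (Cmod p)).
        rewrite Cmod_R, Rabs_pos_eq; lra.
      - rewrite RtoC_minus, Cmod2_conj; ring. }
    pose proof (Cmod_ge_0 (1 - h z)); pose proof (Cmod_ge_0 (z - f z)).
    pose proof (Cmod_ge_0 (1 - Cconj p * p)).
    assert (L4 : b <= Cmod (z - p) * Cmod (1 - Cconj p * f z)).
    { replace b with ((1 - Cmod p) / 2 * (1 - Cmod p)) by (unfold b; field).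
      apply Rmult_le_compat; lra. }
    replace (1 - (1 - s)) with s by ring.
    apply Rmult_le_reg_r with b; [assumption|].
    apply Rle_trans with (Cmod (1 - h z) * (Cmod (z - p) * Cmod (1 - Cconj p * f z))).
    - apply Rmult_le_compat_l; assumption.
    - rewrite <- Rmult_assoc, Hkey.
      apply Rle_trans with (Cmod (z - f z) * 1); [apply Rmult_le_compat_l; lra|lra]. }
  intros q Hq.
  destruct (excluded_middle_informative (q = p)) as [->|Hqp]; [assumption|].
  assert (Hhq : h q = 1).
  { apply boundary_one_uniqueness; auto. }
  specialize (Hkey q Hq); rewrite Hhq in Hkey.
  pose proof (one_minus_conj_mult_neq_0 p p Hp Hp) as Hpp.
  replace (f q) with (q - (q - f q) * (1 - Cconj p * p) / (1 - Cconj p * p))%C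
    by (field; assumption).
  rewrite <- Hkey; field; assumption.
Qed.
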